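(* For all positive integers $m,q$ with $m\not\equiv q\pmod 4$, the polynomial $(1+z^m+z^{2m})(1+z^q+z^{2q})+1$ is an integer expanding polynomial with leading coefficient $1$ and free term $\pm2$.
   Context: A polynomial is called expanding if all its complex roots have modulus strictly greater than $1$. An integer polynomial is a polynomial with integer coefficients. *)

(* Defs.v *)
(* Mathematical Components, with complex numbers R[i] over R : realType. *)
From mathcomp Require Import all_boot all_order all_algebra.
From mathcomp Require Import reals complex.
Set Implicit Arguments.
Unset Strict Implicit.
Unset Printing Implicit Defensive.
Import Order.TTheory GRing.Theory Num.Theory.
Local Open Scope ring_scope.

(* The modulus `|z| is an element of R[i]; the order of R[i] is partial and
   1 < w says that w - 1 is real and positive, so 1 < `|z| is the usual strict
   inequality between reals. *)
Definition expanding (R : realType) (p : {poly R[i]}) : Prop :=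
  forall z : R[i], root p z -> 1 < `|z|.

Definition integer_poly (R : realType) (p : {poly R[i]}) : Prop :=
  forall k : nat, exists a : int, p`_k = a%:~R.

(* Main.v *)
Require Import Defs.
From mathcomp Require Import all_boot all_order all_algebra.
From mathcomp Require Import reals complex ring.
Import Order.TTheory GRing.Theory Num.Theory.
Local Open Scope ring_scope.

(** Put [A(u) = 1 + u + u^2].  On the closed unit disk, [w = A(u)] satisfies
    [|w - 1|^2 <= 1 + |w|].  If [A(u) A(v) = -1], applying this to [w] and to
    [-1/w] and adding gives [(|w| - 1)^2 <= 0], which forces [w^2 = -1] and
    then [u = v = w].  So a root [z] with [|z| <= 1] would have
    [z^m = z^q = w] with [w] a primitive fourth root of unity, whence
    [w^q = z^(m q) = w^m] and [m = q] modulo 4. *)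

Lemma addC_conj_le_norm {C : numClosedFieldType} (x : C) :
  x + x^* <= 2 * `|x|.
Proof.
have xR : x + x^* \is Num.real.
  by rewrite CrealE rmorphD /= conjCK addrC.
apply: (le_trans (real_ler_norm xR)); apply: (le_trans (ler_normD _ _)).
by rewrite norm_conjC mulr_natl mulr2n.
Qed.

Lemma norm_trinomial_disk {C : numClosedFieldType} {u : C} (w := 1 + u + u ^+ 2) :
  `|u| <= 1 -> `|w - 1| ^+ 2 <= 1 + `|w|.
Proof.
move=> u1.
have r1 : u * u^* <= 1 by rewrite -normCK expr_le1.
have r0 : 0 <= u * u^* by rewrite mul_conjC_ge0.
(* Since |conj u| <= 1, |w| is bounded below by Re (w * conj u). *)
have leRe : w * u^* + (w * u^*)^* <= 2 * `|w|.
  apply: (le_trans (addC_conj_le_norm _)).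
  by rewrite ler_pM2l ?ltr0n // normrM norm_conjC ler_piMr.
have s0 : 0 <= (1 + u) * (1 + u)^* + (1 + u * u^*).
  by rewrite addr_ge0 ?mul_conjC_ge0 // addr_ge0.
rewrite -(ler_pM2l (x := 2)) ?ltr0n // [X in _ <= X]mulrDr.
apply: le_trans (lerD (lexx _) leRe).
(* With [w - 1 = u (1 + u)], the difference 2 + 2 Re(w conj u) - 2|w - 1|^2 factors exactly as (1 -
   |u|^2)(|1 + u|^2 + 1 + |u|^2), and both factors are nonnegative on the disk. *)
have d0 : 0 <= (1 - u * u^*) * ((1 + u) * (1 + u)^* + (1 + u * u^*)).
  by rewrite mulr_ge0 // subr_ge0.
rewrite -subr_ge0; apply: le_trans d0 _; rewrite le_eqVlt; apply/orP; left.
apply/eqP; rewrite normCK /w !(rmorphM, rmorphD, rmorphB, rmorphXn, rmorph1) /=.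
by rewrite conjCK; ring.
Qed.

Lemma trinomial_mulN1 {C : numClosedFieldType} {u v : C} :
  `|u| <= 1 -> `|v| <= 1 ->
  (1 + u + u ^+ 2) * (1 + v + v ^+ 2) = -1 -> u ^+ 2 = -1 /\ v = u.
Proof.
move=> u1 v1.
have := norm_trinomial_disk v1; have := norm_trinomial_disk u1 => /=.
set w := 1 + u + u ^+ 2; set w' := 1 + v + v ^+ 2 => hw hw' ww'.
have w0 : w != 0.
  by apply: contra_eq_neq ww' => ->; rewrite mul0r eq_sym oppr_eq0 oner_eq0.
(* This is the disk bound for [w' = -1/w], multiplied through by |w|^2. *)
have hw2 : `|w + 1| ^+ 2 <= `|w| ^+ 2 + `|w|.
  have -> : w + 1 = - (w * (w' - 1)) by rewrite mulrBr ww'; ring.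
  have nww' : `|w| * `|w'| = 1 by rewrite -normrM ww' normrN1.
  rewrite normrN normrM exprMn.
  have -> : `|w| ^+ 2 + `|w| = `|w| ^+ 2 * (1 + `|w'|).
    by rewrite mulrDr mulr1 expr2 -mulrA nww' mulr1.
  by rewrite ler_wpM2l // exprn_ge0.
(* The parallelogram law, to be compared with the sum of the two bounds. *)
have par : `|w - 1| ^+ 2 + `|w + 1| ^+ 2 = 2 * `|w| ^+ 2 + 2.
  by rewrite !normCK !rmorphD rmorphN rmorph1; ring.
have nw : `|w| = 1.
  have : `|w - 1| ^+ 2 + `|w + 1| ^+ 2 <= 1 + `|w| + (`|w| ^+ 2 + `|w|).
    exact: lerD.
  rewrite par -subr_ge0.
  have -> : 1 + `|w| + (`|w| ^+ 2 + `|w|) - (2 * `|w| ^+ 2 + 2)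
            = - (`|w| - 1) ^+ 2 by ring.
  rewrite oppr_ge0 => le0.
  have R : `|w| - 1 \is Num.real by rewrite rpredB ?normr_real ?rpred1.
  have : (`|w| - 1) ^+ 2 == 0 by rewrite eq_le le0 real_exprn_even_ge0.
  by rewrite sqrf_eq0 subr_eq0 => /eqP.
rewrite nw expr1n in hw hw2 par.
(* Once |w| = 1, both squared norms are at most 2 and they add up to 4, so neither bound is
   strict. *)
have hp : `|w + 1| ^+ 2 = 2.
  apply/eqP; rewrite eq_le hw2 /= -(lerD2l (1 + 1)).
  have -> : (1 + 1 + 2 : C) = `|w - 1| ^+ 2 + `|w + 1| ^+ 2 by rewrite par; ring.
  by rewrite lerD2r.
have wwC : w * w^* = 1 by rewrite -normCK nw expr1n.
have wi : w ^+ 2 = -1.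
  (* Expanding |w + 1|^2 = 2 + 2 Re w shows that w is purely imaginary. *)
  have s0 : w + w^* = 0.
    have : `|w + 1| ^+ 2 = w * w^* + 1 + (w + w^*).
      by rewrite normCK rmorphD rmorph1; ring.
    rewrite hp wwC => /eqP; rewrite eq_sym -subr_eq0 => /eqP h.
    by rewrite -[RHS]h; ring.
  have -> : w ^+ 2 = w * (w + w^*) - w * w^* by ring.
  by rewrite s0 wwC mulr0 sub0r.
(* Because w^2 = -1, the equation 1 + x + x^2 = w has the roots w and -(w + 1); the second has
   modulus sqrt 2 and lies outside the disk. *)
have fixw (x : C) : `|x| <= 1 -> 1 + x + x ^+ 2 = w -> x = w.
  move=> x1 xw.
  have /eqP : (x - w) * (x + (w + 1)) = 0.
    have -> : (x - w) * (x + (w + 1)) = (1 + x + x ^+ 2) - w - (w ^+ 2 + 1) by ring.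
    by rewrite xw wi; ring.
  rewrite mulf_eq0 subr_eq0 => /orP [/eqP //|].
  rewrite addr_eq0 => /eqP xE.
  have : `|w + 1| ^+ 2 <= 1 by rewrite -normrN -xE expr_le1.
  by rewrite hp lern1.
have uw : u = w by exact: fixw.
have vw : v = w.
  apply: fixw => //; rewrite -/w'; apply: (mulfI w0).
  by rewrite ww' -expr2 wi.
by rewrite vw uw.
Qed.

(** Order exactly 4 is what turns an equality of powers of w into a congruence of exponents modulo
    4. *)
Lemma sqrN1_prim4 {C : numFieldType} {w : C} :
  w ^+ 2 = -1 -> 4.-primitive_root w.
Proof.
move=> w2.
have N11 : (-1 == 1 :> C) = false.
  by rewrite eq_sym -subr_eq0 opprK -mulr2n pnatr_eq0.
have w1 : (w == 1) = false.
  by apply/negP => /eqP w1; move: w2; rewrite w1 expr1n => /eqP; rewrite eq_sym N11.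
have w3 : (w ^+ 3 == 1) = false.
  apply/negP; rewrite exprS w2 mulrN1 eqr_oppLR => /eqP wN1.
  by move: w2 => /eqP; rewrite wN1 sqrrN expr1n eq_sym N11.
apply/andP; split=> //; apply/forallP => -[[|[|[|[|i]]]] hi] //=;
  rewrite unity_rootE ?expr1 ?w1 ?w2 ?w3 ?N11 //.
by rewrite -[w ^+ 4]/(w ^+ (2 * 2)) exprM w2 sqrrN expr1n !eqxx.
Qed.

Lemma size_trinomialXn {A : nzRingType} {n : nat} :
  (0 < n)%N -> size (1 + 'X^n + 'X^(2 * n) : {poly A}) = (2 * n).+1.
Proof.
move=> n0; rewrite addrC size_polyDl size_polyXn // addrC -polyC1 size_XnaddC //.
by rewrite ltnS ltn_Pmull.
Qed.

Lemma monic_trinomialXn {A : nzRingType} {n : nat} :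
  (0 < n)%N -> (1 + 'X^n + 'X^(2 * n) : {poly A}) \is monic.
Proof.
move=> n0; rewrite monicE lead_coefDr ?lead_coefXn //.
by rewrite size_polyXn addrC -polyC1 size_XnaddC // ltnS ltn_Pmull.
Qed.

Theorem mainTheorem15 (R : realType) (m q : nat)
    (hm : (0 < m)%N) (hq : (0 < q)%N) (hmq : m <> q %[mod 4]) :
  let P : {poly R[i]} :=
    (1 + 'X^m + 'X^(2 * m)) * (1 + 'X^q + 'X^(2 * q)) + 1 in
  [/\ integer_poly P, expanding P, lead_coef P = 1 & P`_0 = 2 \/ P`_0 = - 2].
Proof.
move=> P; split.
- move=> k.
  pose Q : {poly int} := (1 + 'X^m + 'X^(2 * m)) * (1 + 'X^q + 'X^(2 * q)) + 1.
  exists Q`_k; rewrite -[RHS](coef_map intr); congr (_`_k).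
  by rewrite /Q !(rmorphD, rmorphM, rmorph1) /= !map_polyXn.
- move=> z; rewrite rootE /P !hornerE => /eqP Pz.
  rewrite real_ltNge ?normr_real ?real1 //; apply/negP => z1.
  have zm1 : `|z ^+ m| <= 1 by rewrite normrX exprn_ile1.
  have zq1 : `|z ^+ q| <= 1 by rewrite normrX exprn_ile1.
  have [|w2 zqm] := trinomial_mulN1 zm1 zq1.
    by apply/eqP; rewrite -addr_eq0 -!exprM ![(_ * 2)%N]mulnC Pz.
  (* It remains to compare (z^m)^m with (z^m)^q = (z^q)^m, and z^q = z^m. *)
  apply: hmq; apply/eqP; rewrite -(eq_prim_root_expr (sqrN1_prim4 w2)).
  by rewrite -[X in _ == X]exprM mulnC exprM zqm.
(* The product is monic of positive degree, so adding 1 leaves its leading coefficient unchanged. *)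
- rewrite /P lead_coefDl.
    by apply/monicP; rewrite monicMl ?monic_trinomialXn.
  rewrite size_poly1 size_monicM ?monic_trinomialXn //; last first.
    by rewrite monic_neq0 ?monic_trinomialXn.
  by rewrite !size_trinomialXn // addnS /= addSn ltnS addn_gt0 muln_gt0 hm.
(* At 0 both trinomials equal 1, so the free term is always +2. *)
- left; rewrite -horner_coef0 /P !hornerE !expr0n.
  by rewrite !muln_eq0 /= !eqn0Ngt hm hq /=; ring.
Qed.
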